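(* There exists a conformal mapping $f$ on the unit disk $\mathbb{D}$ such that $f\in A_1^3(\mathbb{D})$, $f\notin A_0^2(\mathbb{D})$ and $f\notin H^1(\mathbb{D})$.
   Context: A conformal mapping on $\mathbb{D}$ is an injective holomorphic function $f:\mathbb{D}\to\mathbb{C}$. For $p>0$, $\alpha>-1$, the weighted Bergman space $A_\alpha^p(\mathbb{D})$ is the set of holomorphic $f$ on $\mathbb{D}$ with $\int_{\mathbb{D}}|f(z)|^p(1-|z|^2)^\alpha\,dA(z)<\infty$, where $dA$ is Lebesgue area measure (subscript is the weight $\alpha$, superscript the exponent $p$). The Hardy space $H^p(\mathbb{D})$ is the set of holomorphic $f$ on $\mathbb{D}$ with $\sup_{0<r<1}\int_0^{2\pi}|f(re^{it})|^p\,dt<\infty$. *)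

(* Defs.v *)
From HB Require Import structures.
From mathcomp Require Import all_boot all_order all_algebra.
From mathcomp Require Import all_classical all_reals all_analysis.
From mathcomp Require Import complex.

Set Implicit Arguments.
Unset Strict Implicit.
Unset Printing Implicit Defensive.

Import Order.TTheory GRing.Theory Num.Theory numFieldNormedType.Exports.
Import ComplexField.Normc.

Local Open Scope classical_set_scope.
Local Open Scope ring_scope.
Local Open Scope complex_scope.

(* MathComp-Analysis over an arbitrary R : realType, with complex plane R[i].
   [normc z] is the modulus of z as an element of R; the norm [`|z|] of R[i]
   takes its values in R[i]. *)

Definition unit_disk (R : realType) : set R[i] := [set z | normc z < 1].

(* Functions on the disk are total functions on R[i] of which only the values
   on the disk matter: the disk is open, so derivability at its points depends
   on these values only. R[i]^o is R[i] as a normed space over the field R[i],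
   and derivability there in the direction 1 is complex differentiability. *)
Definition holomorphic_on (R : realType) (D : set R[i]) (f : R[i] -> R[i]) :=
  forall z, D z -> derivable (f : R[i]^o -> R[i]^o) (z : R[i]^o) (1 : R[i]^o).

Definition conformal_mapping (R : realType) (f : R[i] -> R[i]) :=
  holomorphic_on (@unit_disk R) f /\ {in @unit_disk R &, injective f}.

(* Area measure is the product of two copies of Lebesgue measure on R, the
   plane being R * R via w |-> w.1 +i* w.2. *)
Definition area_integral (R : realType) (D : set R[i]) (g : R[i] -> R) : \bar R :=
  (\int[lebesgue_measure \x lebesgue_measure]_
     (w in [set w : R * R | D (w.1 +i* w.2)]) (g (w.1 +i* w.2))%:E)%E.

(* Meant for 0 < p and -1 < alpha. *)
Definition bergman_space (R : realType) (p alpha : R) : set (R[i] -> R[i]) :=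
  [set f | holomorphic_on (@unit_disk R) f /\
     (area_integral (@unit_disk R)
        (fun z => normc (f z) `^ p * (1 - normc z ^+ 2) `^ alpha)%R < +oo)%E].

Definition circle_point (R : realType) (r t : R) : R[i] :=
  (r * cos t) +i* (r * sin t).

(* Meant for 0 < p. *)
Definition hardy_space (R : realType) (p : R) : set (R[i] -> R[i]) :=
  [set f | holomorphic_on (@unit_disk R) f /\
     (ereal_sup [set \int[lebesgue_measure]_(t in `[0%R, (2 * pi)%R])
                       ((normc (f (circle_point r t)) `^ p)%R)%:E
                | r in `]0%R, 1%R[] < +oo)%E].

(* Main.v *)
(* The map is f(z) = sum_k a_k / (1 - z + e_k) with a_k = 16^-k, e_k = 2^-n_k
   and n_k = 512^k.  In the right half-plane w = 1 - z the difference
   f(w1) - f(w2) is w2 - w1 times a positive combination of the numbers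
   1 / ((w1 + e_k) (w2 + e_k)), which lie in a common half-plane when w1 and w2
   lie in the same quadrant; otherwise the imaginary parts of f already differ.
   Hence f is univalent.

   The cube of the A_1^3 norm of 1 / (w + e_k), the square of its A_0^2 norm and
   its H^1 norm are all of order log (1 / e_k), that is of order n_k.  Since
   a_k n_k^(1/3) = 2^-k is summable, f lies in A_1^3.  The terms of the series
   lie in a common quadrant, so |f| >= a_k / |w + e_k| for each k, and
   a_k^2 n_k = 2^k and a_k n_k = 32^k are unbounded. *)

Require Import Defs.
From mathcomp Require Import all_boot all_order all_algebra.
From mathcomp Require Import all_classical all_reals all_analysis.
From mathcomp Require Import measurable_realfun complex ring lra.

Set Implicit Arguments.
Unset Strict Implicit.
Unset Printing Implicit Defensive.

Import Order.TTheory GRing.Theory Num.Theory numFieldNormedType.Exports.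
Import ComplexField.Normc.

Local Open Scope classical_set_scope.
Local Open Scope ring_scope.
Local Open Scope complex_scope.

Notation Re := (@complex.Re _).
Notation Im := (@complex.Im _).

(** * Modulus against real and imaginary parts *)

Lemma sqr_normcE (R : realType) (z : R[i]) :
  normc z ^+ 2 = Re z ^+ 2 + Im z ^+ 2.
Proof. by case: z => x y /=; rewrite sqr_sqrtr// addr_ge0 ?sqr_ge0. Qed.

Lemma normc_ge0 (R : realType) (z : R[i]) : 0 <= normc z.
Proof. by case: z => x y; rewrite /= sqrtr_ge0. Qed.

Lemma normc_normr (R : realType) (z : R[i]) : `|z| = (normc z)%:C.
Proof. by rewrite normc_def; case: z. Qed.

Lemma normr_Re_le (R : realType) (z : R[i]) : `|Re z| <= normc z.
Proof.
rewrite -(ler_pXn2r (n := 2)) ?nnegrE ?normc_ge0//.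
by rewrite sqr_normcE real_normK ?num_real// lerDl sqr_ge0.
Qed.

Lemma normr_Im_le (R : realType) (z : R[i]) : `|Im z| <= normc z.
Proof.
rewrite -(ler_pXn2r (n := 2)) ?nnegrE ?normc_ge0//.
by rewrite sqr_normcE real_normK ?num_real// lerDr sqr_ge0.
Qed.

Lemma normc_le_ReIm (R : realType) (z : R[i]) :
  normc z <= `|Re z| + `|Im z|.
Proof.
rewrite -(ler_pXn2r (n := 2)) ?nnegrE ?normc_ge0 ?addr_ge0//.
rewrite sqr_normcE -[Re z ^+ 2]real_normK ?num_real//.
rewrite -[Im z ^+ 2]real_normK ?num_real// sqrrD.
by rewrite -addrA lerD2l lerDr mulrn_wge0 ?mulr_ge0.
Qed.

Lemma ReD (R : realType) (z w : R[i]) : Re (z + w) = Re z + Re w.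
Proof. by case: z => ? ?; case: w. Qed.

Lemma ImD (R : realType) (z w : R[i]) : Im (z + w) = Im z + Im w.
Proof. by case: z => ? ?; case: w. Qed.

(** * Weighted series of bounded real and complex sequences *)

Definition summable_weight (R : realType) (a : R^nat) :=
  (forall k, 0 < a k) /\ cvgn (series a).

Definition wsum (R : realType) (a u : R^nat) : R :=
  limn (series (fun k => a k * u k)).

(** Summing the coordinates separately keeps every limit in [R], where series can be compared by
    order. *)
Definition csum (R : realType) (a : R^nat) (u : nat -> R[i]) : R[i] :=
  wsum a (Re \o u) +i* wsum a (Im \o u).

Definition cbounded (R : realType) (u : nat -> R[i]) :=
  exists M : R, forall k, normc (u k) <= M.

Lemma is_cvg_wsum_ge0 (R : realType) (a u : R^nat) (M : R) :
  summable_weight a -> (forall k, 0 <= u k <= M) ->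
  cvgn (series (fun k => a k * u k)).
Proof.
move=> [a0 ca] uM.
have a0' k : 0 <= a k by exact: ltW.
have M0 : 0 <= M by have /andP[] := uM 0; exact: le_trans.
apply: (@series_le_cvg _ _ (M *: (a : R^nat))).
- by move=> k; rewrite mulr_ge0//; have /andP[] := uM k.
- by move=> k; rewrite mulr_ge0.
- move=> k; rewrite [leRHS]mulrC; apply: ler_wpM2l => //.
  by have /andP[] := uM k.
- exact: is_cvg_seriesZ.
Qed.

Lemma is_cvg_wsum (R : realType) (a u : R^nat) (M : R) :
  summable_weight a -> (forall k, `|u k| <= M) ->
  cvgn (series (fun k => a k * u k)).
Proof.
move=> wa uM; apply: normed_cvg.
rewrite (_ : [normed _] = series (fun k => a k * `|u k|)).
  by apply: (@is_cvg_wsum_ge0 _ _ _ M) => // k; rewrite normr_ge0 uM.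
apply/funext => n; apply: eq_bigr => k _ /=.
by rewrite normrM gtr0_norm//; exact: wa.1.
Qed.

Lemma wsumD (R : realType) (a u v : R^nat) (M N : R) :
  summable_weight a -> (forall k, `|u k| <= M) -> (forall k, `|v k| <= N) ->
  wsum a (fun k => u k + v k) = wsum a u + wsum a v.
Proof.
move=> wa uM vN; rewrite /wsum -lim_seriesD.
- by congr (limn (series _)); apply/funext => k /=; rewrite mulrDr.
- exact: (@is_cvg_wsum _ _ _ M).
- exact: (@is_cvg_wsum _ _ _ N).
Qed.

Lemma wsumZ (R : realType) (a u : R^nat) (M c : R) :
  summable_weight a -> (forall k, `|u k| <= M) ->
  wsum a (fun k => c * u k) = c * wsum a u.
Proof.
move=> wa uM; rewrite /wsum -[RHS]lim_seriesZ.
- by congr (limn (series _)); apply/funext => k /=; rewrite mulrCA.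
- exact: (@is_cvg_wsum _ _ _ M).
Qed.

Lemma wsum_ge_term (R : realType) (a u : R^nat) (M : R) k :
  summable_weight a -> (forall k, 0 <= u k <= M) ->
  a k * u k <= wsum a u.
Proof.
move=> wa uM.
have au0 n : 0 <= a n * u n.
  by rewrite mulr_ge0 ?(ltW (wa.1 n))//; have /andP[] := uM n.
apply: (@le_trans _ _ (series (fun k => a k * u k) k.+1)).
  by rewrite seriesSr/= lerDr sumr_ge0.
apply: nondecreasing_cvgn_le; last exact: (@is_cvg_wsum_ge0 _ _ _ M).
exact: nondecreasing_series.
Qed.

Lemma ler_norm_wsum (R : realType) (a u v : R^nat) (M : R) :
  summable_weight a -> (forall k, `|u k| <= v k <= M) ->
  `|wsum a u| <= wsum a v.
Proof.
move=> wa uvM.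
have uv k : `|u k| <= v k by have /andP[] := uvM k.
have v0 k : 0 <= v k by exact: le_trans (uv k).
have vM k : v k <= M by have /andP[] := uvM k.
have normv k : `|v k| <= M by rewrite ger0_norm.
have normNv k : `|-1 * v k| <= M by rewrite mulN1r normrN.
have cvu := is_cvg_wsum wa (fun k => le_trans (uv k) (vM k)).
have cvv := is_cvg_wsum wa normv.
have uvN k : - v k <= u k <= v k by rewrite -ler_norml.
rewrite ler_norml; apply/andP; split.
  rewrite -mulN1r -(wsumZ _ wa normv).
  apply: lim_series_le => //; first exact: (is_cvg_wsum wa normNv).
  move=> k; rewrite ler_wpM2l ?(ltW (wa.1 k))// mulN1r.
  by have /andP[] := uvN k.
apply: lim_series_le => // k; rewrite ler_wpM2l ?(ltW (wa.1 k))//.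
by have /andP[] := uvN k.
Qed.

Lemma csumD (R : realType) (a : R^nat) (u v : nat -> R[i]) :
  summable_weight a -> cbounded u -> cbounded v ->
  csum a (fun k => u k + v k) = csum a u + csum a v.
Proof.
move=> wa [M uM] [N vN].
apply/eqP; rewrite eq_complex ReD ImD/=; apply/andP; split; apply/eqP.
- rewrite -(@wsumD _ _ _ _ M N)//; last 2 first.
  + by move=> k; exact: le_trans (normr_Re_le _) (uM k).
  + by move=> k; exact: le_trans (normr_Re_le _) (vN k).
  by congr wsum; apply/funext => k /=; rewrite ReD.
- rewrite -(@wsumD _ _ _ _ M N)//; last 2 first.
  + by move=> k; exact: le_trans (normr_Im_le _) (uM k).
  + by move=> k; exact: le_trans (normr_Im_le _) (vN k).
  by congr wsum; apply/funext => k /=; rewrite ImD.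
Qed.

Lemma csumZ (R : realType) (a : R^nat) (u : nat -> R[i]) (c : R[i]) :
  summable_weight a -> cbounded u ->
  csum a (fun k => c * u k) = c * csum a u.
Proof.
move=> wa [M uM].
have uR k : `|Re (u k)| <= M by exact: le_trans (normr_Re_le _) (uM k).
have uI k : `|Im (u k)| <= M by exact: le_trans (normr_Im_le _) (uM k).
have scaled (d : R) (v : R^nat) : (forall k, `|v k| <= M) ->
    forall k, `|d * v k| <= `|d| * M.
  by move=> vM k; rewrite normrM ler_wpM2l.
case: c => x y; rewrite /csum; apply/eqP; rewrite eq_complex/=.
apply/andP; split; apply/eqP.
- rewrite -mulNr -2?(@wsumZ _ _ _ M)//.
  rewrite -(@wsumD _ _ _ _ (`|x| * M) (`|- y| * M))//; last 2 first.
    exact: scaled.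
    exact: scaled.
  by congr wsum; apply/funext => k /=; case: (u k) => ? ?; rewrite /= mulNr.
- rewrite -2?(@wsumZ _ _ _ M)//.
  rewrite -(@wsumD _ _ _ _ (`|x| * M) (`|y| * M))//; last 2 first.
    exact: scaled.
    exact: scaled.
  by congr wsum; apply/funext => k /=; case: (u k) => ? ?.
Qed.

(** The factor 2 is the cost of bounding each coordinate of the sum by [wsum a v]. *)
Lemma normc_csum_le (R : realType) (a : R^nat) (u : nat -> R[i])
    (v : R^nat) (M : R) :
  summable_weight a -> (forall k, normc (u k) <= v k <= M) ->
  normc (csum a u) <= 2 * wsum a v.
Proof.
move=> wa uvM; apply: le_trans (normc_le_ReIm _) _.
have uR k : `|(Re \o u) k| <= v k <= M.
  by have /andP[uv ->] := uvM k; rewrite (le_trans (normr_Re_le _)).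
have uI k : `|(Im \o u) k| <= v k <= M.
  by have /andP[uv ->] := uvM k; rewrite (le_trans (normr_Im_le _)).
have := ler_norm_wsum wa uR; have := ler_norm_wsum wa uI.
by rewrite /csum /=; lra.
Qed.

(** * Stieltjes transform of the measure with masses [a k] at [e k]: resolvent identities,
    derivative *)

Definition stieltjes (R : realType) (a e : R^nat) (w : R[i]) : R[i] :=
  csum a (fun k => (w + (e k)%:C)^-1).

Lemma ReDr (R : realType) (w : R[i]) (e : R) : Re (w + e%:C) = Re w + e.
Proof. by rewrite ReD. Qed.

Lemma ImDr (R : realType) (w : R[i]) (e : R) : Im (w + e%:C) = Im w.
Proof. by rewrite ImD/= addr0. Qed.

Lemma ReN (R : realType) (w : R[i]) : Re (- w) = - Re w.
Proof. by case: w. Qed.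

Lemma neq0_Re_gt0 (R : realType) (w : R[i]) : 0 < Re w -> w != 0.
Proof. by apply: contraTneq => ->; rewrite ltxx. Qed.

Lemma addr_real_neq0 (R : realType) (w : R[i]) (e : R) :
  0 < Re w -> 0 <= e -> w + e%:C != 0.
Proof. by move=> w0 e0; rewrite neq0_Re_gt0// ReDr ltr_pwDl. Qed.

Lemma normc_inv_shift_le (R : realType) (w : R[i]) (d e : R) :
  0 < d -> d <= Re w -> 0 <= e -> normc (w + e%:C)^-1 <= d^-1.
Proof.
move=> d0 dw e0; rewrite normcV lef_pV2 ?posrE//.
  apply: le_trans (normr_Re_le _); rewrite ReDr.
  by apply: le_trans (ler_norm _); rewrite -[d]addr0 lerD.
apply: lt_le_trans (normr_Re_le _); rewrite ReDr.
by apply: lt_le_trans (ler_norm _); rewrite ltr_pwDl// (lt_le_trans d0).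
Qed.

Lemma cbounded_inv_shift (R : realType) (e : R^nat) (w : R[i]) :
  (forall k, 0 <= e k) -> 0 < Re w -> cbounded (fun k => (w + (e k)%:C)^-1).
Proof. by move=> e0 w0; exists (Re w)^-1 => k; exact: normc_inv_shift_le. Qed.

Lemma cboundedM (R : realType) (u v : nat -> R[i]) :
  cbounded u -> cbounded v -> cbounded (fun k => u k * v k).
Proof.
move=> [M uM] [N vN]; exists (M * N) => k.
by rewrite normcM ler_pM ?normc_ge0.
Qed.

Lemma cboundedZ (R : realType) (u : nat -> R[i]) (c : R[i]) :
  cbounded u -> cbounded (fun k => c * u k).
Proof. by apply: cboundedM; exists (normc c). Qed.

Section stieltjes.
Context (R : realType) (a e : R^nat).
Hypotheses (wa : summable_weight a) (e0 : forall k, 0 <= e k).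
Implicit Types w : R[i].
Let q w k := (w + (e k)%:C)^-1.

(** Resolvent identity, solved for [q w1 k] so that [csumD] and [csumZ] sum it. *)
Let qB w1 w2 k : 0 < Re w1 -> 0 < Re w2 ->
  q w1 k = q w2 k + (w2 - w1) * (q w1 k * q w2 k).
Proof.
move=> h1 h2; rewrite /q.
have := addr_real_neq0 h1 (e0 k); have := addr_real_neq0 h2 (e0 k).
by move=> ? ?; field; apply/andP.
Qed.

Lemma stieltjesB w1 w2 : 0 < Re w1 -> 0 < Re w2 ->
  stieltjes a e w1 - stieltjes a e w2 =
  (w2 - w1) * csum a (fun k => q w1 k * q w2 k).
Proof.
move=> h1 h2; rewrite {1}/stieltjes (eq_fun (fun k => qB k h1 h2)).
have b1 := cbounded_inv_shift e0 h1; have b2 := cbounded_inv_shift e0 h2.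
rewrite csumD//; last by apply: cboundedZ; exact: cboundedM.
by rewrite csumZ//; [rewrite addrC addKr|exact: cboundedM].
Qed.

(** The left side compares a difference quotient with the derivative; the factor [w2 - w1] on the
    right makes the error vanish in the limit. *)
Lemma csum_qqB w1 w2 : 0 < Re w1 -> 0 < Re w2 ->
  csum a (fun k => q w1 k * q w2 k) - csum a (fun k => q w2 k * q w2 k) =
  (w2 - w1) * csum a (fun k => q w1 k * q w2 k * q w2 k).
Proof.
move=> h1 h2.
have b1 := cbounded_inv_shift e0 h1; have b2 := cbounded_inv_shift e0 h2.
have b3 : cbounded (fun k => q w1 k * q w2 k * q w2 k).
  by apply: cboundedM => //; exact: cboundedM.
rewrite -csumZ//.
rewrite (_ : (fun k => q w1 k * q w2 k) = (fun k => q w2 k * q w2 k +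
    (w2 - w1) * (q w1 k * q w2 k * q w2 k))); last first.
  by apply/funext => k; rewrite {1}(qB k h1 h2); ring.
rewrite csumD//; [by rewrite addrC addKr|exact: cboundedM|exact: cboundedZ].
Qed.

Lemma derivable_stieltjes1B (z : R[i]) : Re z < 1 ->
  derivable (fun z : R[i]^o => stieltjes a e (1 - z) : R[i]^o) z 1.
Proof.
move=> z1; set w := 1 - z; set d := Re w.
have d0 : 0 < d by rewrite /d /w ReD; case: (z) z1 => x y /=; lra.
(* [K] bounds the triple product [q (w - h) k * q w k * q w k] for [normc h < d / 2], where
   [Re (w - h)] is at least [d / 2]. *)
pose K := (d / 2)^-1 * d^-1 * d^-1; pose C := 2 * wsum a (cst K).
apply/cvg_ex; exists (csum a (fun k => q w k * q w k)).
(* The tolerance is a complex number; its positivity means [s = 0] and [0 < r]. *)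
apply/cvgrPdist_le => -[r s] /=; rewrite ltcE/= => /andP[/eqP -> r0].
have C0 : 0 < C + 1.
  have K0 : 0 <= K by rewrite !mulr_ge0 ?invr_ge0 ?divr_ge0 ?(ltW d0).
  rewrite ltr_wpDl// mulr_ge0//.
  apply: le_trans (@wsum_ge_term _ _ (cst K) K 0 wa _); last first.
    by move=> k; rewrite /= lexx K0.
  by rewrite mulr_ge0// (ltW (wa.1 _)).
have near0 : \forall h \near (0 : R[i]^o)^', h != 0.
  exact: (@nbhs_dnbhs_neq R[i]^o 0).
have near_lt t : 0 < t -> \forall h \near (0 : R[i]^o)^', normc h < t.
  move=> t0; have : 0 < t%:C by rewrite ltcE/= eqxx.
  move=> /(@dnbhs0_lt _ R[i]^o); apply: filterS => h.
  by rewrite normc_normr ltcE/= => /andP[].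
near=> h.
have h0 : h != 0 by near: h; apply: near0.
have hd : normc h < d / 2 by near: h; apply: near_lt; rewrite divr_gt0.
have hr : normc h < r / (C + 1) by near: h; apply: near_lt; rewrite divr_gt0.
have wh : d / 2 <= Re (w - h).
  have := le_trans (ler_norm _) (normr_Re_le h).
  by rewrite ReD ReN -/d; lra.
have wh0 : 0 < Re (w - h) by rewrite (lt_le_trans _ wh)// divr_gt0.
rewrite scaler1 /= -/w (_ : 1 - (h + z) = w - h); last by rewrite /w; ring.
rewrite (stieltjesB wh0 d0).
rewrite (_ : w - (w - h) = h); last by ring.
rewrite [_ *: _](_ : _ = csum a (fun k => q (w - h) k * q w k)); last first.
  exact: mulKf.
rewrite distrC.
rewrite (csum_qqB wh0 d0) (_ : w - (w - h) = h); last by ring.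
rewrite normc_normr lecE/= eqxx/= normcM.
have CC : normc (csum a (fun k => q (w - h) k * q w k * q w k)) <= C.
  apply: (@normc_csum_le _ _ _ (cst K) K) => // k; rewrite /= lexx andbT !normcM.
  rewrite ler_pM ?mulr_ge0 ?normc_ge0//; last exact: normc_inv_shift_le.
  rewrite ler_pM ?normc_ge0//; last exact: normc_inv_shift_le.
  by apply: normc_inv_shift_le => //; rewrite divr_gt0.
apply: (@le_trans _ _ (r / (C + 1) * (C + 1))).
  by rewrite ler_pM ?normc_ge0 ?(ltW hr)// (le_trans CC)// lerDl.
by rewrite divfK// gt_eqF.
Unshelve. all: by end_near.
Qed.

End stieltjes.

(** * Univalence and absence of cancellation in the right half-plane *)

Lemma ReV (R : realType) (w : R[i]) : Re w^-1 = Re w / normc w ^+ 2.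
Proof. by rewrite sqr_normcE; case: w. Qed.

Lemma ImV (R : realType) (w : R[i]) : Im w^-1 = - (Im w / normc w ^+ 2).
Proof. by rewrite sqr_normcE; case: w. Qed.

Lemma Im_mul (R : realType) (w z : R[i]) :
  Im (w * z) = Re w * Im z + Im w * Re z.
Proof. by case: w => a b; case: z => c d. Qed.

Lemma Re_mul (R : realType) (w z : R[i]) :
  Re (w * z) = Re w * Re z - Im w * Im z.
Proof. by case: w => a b; case: z => c d. Qed.

Section stieltjes_univalent.
Context (R : realType) (a e : R^nat).
Hypotheses (wa : summable_weight a) (e0 : forall k, 0 <= e k).
Implicit Types w : R[i].
Let q w k := (w + (e k)%:C)^-1.

Let q_le w k : 0 < Re w -> normc (q w k) <= (Re w)^-1.
Proof. by move=> w0; exact: normc_inv_shift_le. Qed.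

Let sq w k := normc (q w k) ^+ 2.

Let sq_ge0 w k : 0 <= sq w k.
Proof. exact: sqr_ge0. Qed.

Let sq_bounds w k : 0 < Re w -> 0 <= sq w k <= (Re w)^-1 ^+ 2.
Proof.
move=> w0; rewrite sqr_ge0/= /sq ler_pXn2r ?nnegrE ?normc_ge0 ?q_le//.
by rewrite invr_ge0 ltW.
Qed.

Let Im_q w k : Im (q w k) = - Im w * sq w k.
Proof. by rewrite /q ImV ImDr mulNr /sq normcV exprVn. Qed.

Let Re_q w k : Re (q w k) = (Re w + e k) * sq w k.
Proof. by rewrite /q ReV ReDr /sq normcV exprVn. Qed.

(** As the [e k] are real, [Im w] factors out of the sum. The other factor is positive, so the value
    determines the sign of [Im w]. *)
Lemma Im_stieltjes w : 0 < Re w -> Im (stieltjes a e w) = - Im w * wsum a (sq w).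
Proof.
move=> w0; rewrite -(@wsumZ _ _ _ ((Re w)^-1 ^+ 2))//.
  by rewrite /=; congr wsum; apply/funext => k /=; rewrite -Im_q.
by move=> k; have /andP[s0 ?] := sq_bounds k w0; rewrite ger0_norm.
Qed.

Let sq_gt0 w k : 0 < Re w -> 0 < sq w k.
Proof.
move=> w0; rewrite exprn_gt0// lt_neqAle normc_ge0 andbT eq_sym.
apply/eqP => /eq0_normc /eqP; rewrite invr_eq0 => /negPn; apply/negP.
by rewrite negbK addr_real_neq0.
Qed.

Let wsum_sq_gt0 w : 0 < Re w -> 0 < wsum a (sq w).
Proof.
move=> w0; apply: lt_le_trans (wsum_ge_term 0 wa (fun k => sq_bounds k w0)).
by rewrite mulr_gt0 ?sq_gt0//; exact: wa.1.
Qed.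

(* In a common closed quadrant the numbers 1 / ((w1 + e) (w2 + e)) all lie in
   one closed half-plane, so that no positive combination of them vanishes. *)
Lemma csum_qq_neq0 w1 w2 : 0 < Re w1 -> 0 < Re w2 -> 0 <= Im w1 * Im w2 ->
  csum a (fun k => q w1 k * q w2 k) != 0.
Proof.
move=> h1 h2 h12; apply/eqP => T0.
have bnd k : normc (q w1 k * q w2 k) <= (Re w1)^-1 * (Re w2)^-1.
  by rewrite normcM ler_pM ?normc_ge0 ?q_le.
have bR k := le_trans (normr_Re_le (q w1 k * q w2 k)) (bnd k).
have bI k := le_trans (normr_Im_le (q w1 k * q w2 k)) (bnd k).
have TR : wsum a (Re \o (fun k => q w1 k * q w2 k)) = 0 by have := congr1 Re T0.
have TI : wsum a (Im \o (fun k => q w1 k * q w2 k)) = 0 by have := congr1 Im T0.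
(* One sign [s] makes both imaginary parts nonnegative, which treats the two quadrants at once. *)
have [s s1 [sy1 sy2]] : exists2 s : R, s \in [:: 1; -1] &
    0 <= s * Im w1 /\ 0 <= s * Im w2.
  have [y1|y1|y1] := ltgtP 0 (Im w1).
  - by exists 1; rewrite ?inE ?eqxx// !mul1r (ltW y1) -(pmulr_rge0 _ y1).
  - exists (-1); rewrite ?inE ?eqxx ?orbT// !mulN1r !oppr_ge0 (ltW y1).
    by rewrite -(nmulr_rge0 _ y1).
  - have [y2|y2] := leP 0 (Im w2).
      by exists 1; rewrite ?inE ?eqxx// !mul1r y2 -y1.
    by exists (-1); rewrite ?inE ?eqxx ?orbT// !mulN1r !oppr_ge0 (ltW y2) -y1.
have ns : `|- s| = 1.
  by move: s1; rewrite !inE normrN => /orP[] /eqP ->; rewrite ?normrN normr1.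
have ImE k : - s * Im (q w1 k * q w2 k) =
    ((Re w1 + e k) * (s * Im w2) + (s * Im w1) * (Re w2 + e k)) *
    (sq w1 k * sq w2 k).
  by rewrite Im_mul !Im_q !Re_q; ring.
have Im0 k : 0 <= - s * Im (q w1 k * q w2 k).
  have h1' := addr_ge0 (ltW h1) (e0 k); have h2' := addr_ge0 (ltW h2) (e0 k).
  rewrite ImE; apply: mulr_ge0; last by apply: mulr_ge0; exact: sq_ge0.
  by apply: addr_ge0; exact: mulr_ge0.
(* Nonnegative terms with weighted sum zero: the term of index 0 cannot be positive. *)
have : a 0 * (- s * Im (q w1 0 * q w2 0)) <= 0.
  have := @wsumZ _ _ _ _ (- s) wa bI; rewrite TI mulr0 => <-.
  apply: (@wsum_ge_term _ _ _ ((Re w1)^-1 * (Re w2)^-1) 0 wa) => k.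
  by rewrite Im0/= (le_trans (ler_norm _))// normrM ns mul1r.
rewrite pmulr_rle0; last exact: wa.1.
have sq12 : 0 < sq w1 0 * sq w2 0 by rewrite mulr_gt0 ?sq_gt0.
have x1 : 0 < Re w1 + e 0 by rewrite ltr_pwDl.
have x2 : 0 < Re w2 + e 0 by rewrite ltr_pwDl.
rewrite ImE pmulr_lle0// => le0.
have p1 : 0 <= (Re w1 + e 0) * (s * Im w2) by rewrite mulr_ge0// ltW.
have p2 : 0 <= s * Im w1 * (Re w2 + e 0) by rewrite mulr_ge0// ltW.
have s0 : s != 0.
  by move: s1; rewrite !inE => /orP[] /eqP ->; rewrite ?oppr_eq0 oner_neq0.
(* Both summands of [ImE] at index 0 vanish. Once [w2] is real, every product has positive real
   part, against [TR]. *)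
have y2 : Im w2 = 0.
  have : (Re w1 + e 0) * (s * Im w2) == 0 by rewrite eq_le p1 andbT; lra.
  by rewrite !mulf_eq0 (gt_eqF x1) (negbTE s0)/= => /eqP.
have Re0 k : 0 < Re (q w1 k * q w2 k).
  rewrite Re_mul !Im_q y2 oppr0 mul0r mulr0 subr0 !Re_q.
  by apply: mulr_gt0; (apply: mulr_gt0; [rewrite ltr_pwDl|exact: sq_gt0]).
have : a 0 * Re (q w1 0 * q w2 0) <= 0.
  rewrite -[leRHS]TR.
  apply: (@wsum_ge_term _ _ _ ((Re w1)^-1 * (Re w2)^-1) 0 wa) => k.
  by rewrite (ltW (Re0 k))/= (le_trans (ler_norm _)).
by rewrite leNgt mulr_gt0//; exact: wa.1.
Qed.

(** Equal imaginary parts of the values put [w1] and [w2] in a common closed quadrant, where the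
    second factor in [stieltjesB] is nonzero. *)
Lemma stieltjes_inj w1 w2 : 0 < Re w1 -> 0 < Re w2 ->
  stieltjes a e w1 = stieltjes a e w2 -> w1 = w2.
Proof.
move=> h1 h2 E.
have := congr1 Im E; rewrite !Im_stieltjes// !mulNr => /oppr_inj EI.
have := stieltjesB wa e0 h1 h2; rewrite E subrr => /esym/eqP; rewrite mulf_eq0.
move=> /orP[|/negPn/negP[]]; first by rewrite subr_eq0 => /eqP.
apply: csum_qq_neq0 => //.
(* Multiplied by the positive [wsum a (sq w2)], the product becomes [Im w1 ^+ 2 * wsum a (sq w1)] by
   [EI]. *)
rewrite -(pmulr_lge0 _ (wsum_sq_gt0 h2)) -mulrA -EI mulrA -expr2.
by rewrite mulr_ge0 ?sqr_ge0// ltW// wsum_sq_gt0.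
Qed.

(** All terms have positive real part and imaginary part of the sign of [- Im w], so each coordinate
    of the sum dominates that of a single term. *)
Lemma normc_stieltjes_ge w k : 0 < Re w ->
  a k / normc (w + (e k)%:C) <= normc (stieltjes a e w).
Proof.
move=> w0; have ak0 : 0 <= a k by exact/ltW/wa.1.
rewrite -normcV -/(q w k) -(ler_pXn2r (n := 2)) ?nnegrE ?normc_ge0//; last first.
  by rewrite mulr_ge0// normc_ge0.
rewrite exprMn !sqr_normcE mulrDr -!exprMn lerD//.
- have Rq0 n : 0 <= Re (q w n).
    by rewrite Re_q mulr_ge0 ?addr_ge0// ltW// sq_gt0.
  have Rq : a k * Re (q w k) <= Re (stieltjes a e w).
    apply: (@wsum_ge_term _ _ _ (Re w)^-1 k wa) => n /=.
    by rewrite Rq0 (le_trans (ler_norm _))// (le_trans (normr_Re_le _))// q_le.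
  have aR0 : 0 <= a k * Re (q w k) by rewrite mulr_ge0.
  by rewrite ler_pXn2r// nnegrE// (le_trans aR0).
- rewrite Im_stieltjes// Im_q mulrCA !exprMn ler_wpM2l ?sqr_ge0//.
  have as0 : 0 <= a k * sq w k by rewrite mulr_ge0 ?sq_ge0.
  have as1 := wsum_ge_term k wa (fun n => sq_bounds n w0).
  suff : (a k * sq w k) ^+ 2 <= wsum a (sq w) ^+ 2 by rewrite !exprMn.
  by rewrite ler_pXn2r// nnegrE// (le_trans as0).
Qed.

End stieltjes_univalent.

(** * Integrals of step functions *)

Section integral_lemmas.
Local Open Scope ereal_scope.
Context d (T : measurableType d) (R : realType).
Variable mu : {measure set T -> \bar R}.

(* Unlike [ge0_le_integral], this needs no measurability: the integral of a
   nonnegative function is a supremum over the simple functions below it. *)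
Lemma nonneg_le_integral (f g : T -> \bar R) :
  (forall x, 0 <= f x) -> (forall x, f x <= g x) ->
  \int[mu]_x f x <= \int[mu]_x g x.
Proof.
move=> f0 fg; rewrite !ge0_integralTE//; last first.
  by move=> x; exact: le_trans (fg x).
apply: le_ereal_sup => _ [h /= hf <-]; exists h => //= x.
exact: le_trans (fg x).
Qed.

Lemma integral_sum_indic (N : nat) (c : nat -> R) (A : nat -> set T) :
  (forall i, (0 <= c i)%R) -> (forall i, measurable (A i)) ->
  \int[mu]_x (\sum_(i < N) c i * \1_(A i) x)%R%:E =
  \sum_(i < N) (c i)%:E * mu (A i).
Proof.
move=> c0 mA.
have mi i : measurable_fun [set: T] (fun x => (c i * \1_(A i) x)%R).
  by apply: measurable_funM; [exact: measurable_cst|exact: measurable_indic].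
under eq_integral do rewrite -sumEFin.
rewrite (@ge0_integral_sum _ _ _ mu _ measurableT _
  (fun (i : 'I_N) x => (c i * \1_(A i) x)%:E)).
- apply: eq_bigr => i _.
  under eq_integral do rewrite EFinM.
  rewrite ge0_integralZl_EFin//; last first.
    by apply/measurable_EFinP; exact: measurable_indic.
  by rewrite integral_indic// setIT.
- by move=> i; apply/measurable_EFinP; exact: mi.
- by move=> i x _; rewrite lee_fin mulr_ge0.
Qed.

End integral_lemmas.

(** At most one summand is nonzero at [x]; [0 <= M] covers the case of none. *)
Lemma sum_indic_le (R : realType) T (N : nat) (c : nat -> R) (A : nat -> set T)
    (x : T) (M : R) :
  (forall i j, A i x -> A j x -> i = j) -> 0 <= M ->
  (forall i, (i < N)%N -> A i x -> c i <= M) ->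
  \sum_(i < N) c i * \1_(A i) x <= M.
Proof.
move=> Ainj M0 cM.
have [[i Aix]|nA] := pselect (exists i : 'I_N, A i x); last first.
  rewrite big1// => i _; rewrite indicE memNset ?mulr0// => Aix.
  by apply: nA; exists i.
rewrite (bigD1 i)//= big1 ?addr0.
  by rewrite indicE mem_set// mulr1 cM.
move=> j ji; rewrite indicE memNset ?mulr0// => Ajx.
by move/eqP: ji; apply; apply/val_inj; exact: Ainj.
Qed.

(** * Dyadic scales and elementary inequalities *)

Lemma expr2VS (R : realType) i : 2 ^- i.+1 = 2 ^- i / 2 :> R.
Proof. by rewrite exprS invfM mulrC. Qed.

Lemma expr2V_gt0 (R : realType) i : 0 < 2 ^- i :> R.
Proof. by rewrite invr_gt0 exprn_gt0. Qed.

Lemma ler_expr2V (R : realType) i j : (i <= j)%N -> 2 ^- j <= 2 ^- i :> R.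
Proof. by move=> ij; rewrite lef_pV2 ?posrE ?exprn_gt0// ler_weXn2l// ler1n. Qed.

(** Each halving splits off one half-open band; the first alternative is what remains below the
    cut-off. *)
Lemma dyadic_scale (R : realType) (m r : R) N : m <= r ->
  m <= r * 2 ^- N \/
  exists2 i, (i < N)%N & r * 2 ^- i.+1 < m <= r * 2 ^- i.
Proof.
move=> mr; elim: N => [|N [IH|[i iN H]]].
- by left; rewrite expr0 invr1 mulr1.
- have [?|?] := leP m (r * 2 ^- N.+1); first by left.
  by right; exists N => //; apply/andP.
- by right; exists i => //; exact: ltnW.
Qed.

Lemma dyadic_scale_uniq (R : realType) (m : R) i j :
  2 ^- i.+1 < m <= 2 ^- i -> 2 ^- j.+1 < m <= 2 ^- j -> i = j.
Proof.
have wlog_ij k l : 2 ^- k.+1 < m -> m <= 2 ^- l -> (l <= k)%N.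
  move=> km ml; rewrite leqNgt; apply/negP => kl.
  by have := lt_le_trans km (le_trans ml (ler_expr2V R kl)); rewrite ltxx.
by move=> /andP[i1 i2] /andP[j1 j2]; apply/eqP; rewrite eqn_leq !wlog_ij.
Qed.

(** Jensen's inequality for the cube, the missing mass [2 ^- N] sitting at the value 0. The
    induction views the sum as the midpoint of [h 0] and the shifted sum. *)
Lemma cube_convex_sum (R : realType) N (h : R^nat) : (forall k, 0 <= h k) ->
  (\sum_(k < N) 2 ^- k.+1 * h k) ^+ 3 <= \sum_(k < N) 2 ^- k.+1 * h k ^+ 3.
Proof.
elim: N h => [|N IH] h h0; first by rewrite !big_ord0 expr0n.
rewrite !big_ord_recl /=.
have half (g : R^nat) : \sum_(i < N) 2 ^- (bump 0 i).+1 * g i.+1 =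
    2^-1 * \sum_(i < N) 2 ^- i.+1 * g i.+1.
  rewrite mulr_sumr; apply: eq_bigr => i _.
  by rewrite /bump/= add1n [in LHS]expr2VS mulrAC [LHS]mulrC.
rewrite (half h) (half (fun k => h k ^+ 3)) expr1.
set t := \sum_(_ < _) _; set t3 := \sum_(_ < _) _.
have t0 : 0 <= t by apply: sumr_ge0 => i _; rewrite mulr_ge0// ltW// expr2V_gt0.
have le_t : t ^+ 3 <= t3 by exact: (IH (fun k => h k.+1)).
have {}h0 := h0 0%N.
apply: (@le_trans _ _ (2^-1 * h 0%N ^+ 3 + 2^-1 * t ^+ 3)); last lra.
rewrite -subr_ge0.
(* Midpoint convexity of the cube as an exact identity. *)
rewrite (_ : _ - _ = 3 / 8 * (h 0%N + t) * (h 0%N - t) ^+ 2); last by field.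
by rewrite mulr_ge0 ?sqr_ge0// mulr_ge0 ?addr_ge0 ?divr_ge0.
Qed.

Lemma sin_le (R : realType) (t : R) : 0 <= t -> sin t <= t.
Proof.
move=> t0; have [|c _] := MVT_segment t0 (fun x _ => is_derive_sin x).
  by apply: continuous_subspaceT => x; exact: continuous_sin.
rewrite sin0 !subr0 => ->.
by rewrite -[leRHS]mul1r ler_wpM2r// cos_le1.
Qed.

(** Half-angle formula and [sin_le]; [t <= 2] keeps [sin (t / 2)] nonnegative, so that the bound can
    be squared. *)
Lemma cos_ge (R : realType) (t : R) : 0 <= t <= 2 -> 1 - cos t <= t ^+ 2 / 2.
Proof.
move=> /andP[t0 t2]; rewrite [cos t](_ : _ = cos ((t / 2) *+ 2)); last first.
  by congr cos; rewrite mulr2n; lra.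
rewrite cos_mulr2n cos2sin2.
have s0 : 0 <= sin (t / 2).
  have [->|tn0] := eqVneq t 0; first by rewrite mul0r sin0.
  by apply/ltW/sin2_gt0; rewrite divr_gt0 ?lt_neqAle 1?eq_sym ?tn0//=; lra.
have s1 : sin (t / 2) <= t / 2 by apply: sin_le; rewrite divr_ge0.
have : sin (t / 2) ^+ 2 <= (t / 2) ^+ 2.
  by rewrite ler_pXn2r// nnegrE divr_ge0.
rewrite (_ : t ^+ 2 / 2 = (t / 2) ^+ 2 *+ 2); last by rewrite mulr2n; field.
rewrite !mulr2n; move: (sin _ ^+ 2) ((t / 2) ^+ 2) => x y.
lra.
Qed.

Lemma unbounded_exp2 (R : realType) (c : R) (x : \bar R) : 0 < c ->
  (forall k, ((c * 2 ^+ k)%:E <= x)%E) -> ~ (x < +oo)%E.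
Proof.
move=> c0 cx; case: x cx => [r|//|] cx; last by have := cx 0.
move=> _; have {}cx k : k%:R <= r / c.
  rewrite ler_pdivlMr// mulrC.
  apply: (@le_trans _ _ (c * 2 ^+ k)); last by rewrite -lee_fin cx.
  by rewrite ler_pM2l// -natrX ler_nat ltnW// ltn_expl.
have := cx (Num.truncn (r / c)).+1.
by rewrite leNgt truncnS_gt.
Qed.

(* The factor 4^(k+1) comes from convexity of the cube with the weights
   2^-(k+1), applied to the rescaled terms 2^(k+1) a_k v_k. *)
Lemma wsum_cube_le (R : realType) (a v b : R^nat) (M c : R) :
  summable_weight a -> (forall k, 0 <= v k <= M) -> 0 <= c ->
  (forall k, v k ^+ 3 * c <= b k) ->
  ((wsum a v ^+ 3 * c)%:E <=
   \sum_(0 <= k <oo) (4 ^+ k.+1 * a k ^+ 3 * b k)%:E)%E.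
Proof.
move=> wa vM c0 vb.
have v0 k : 0 <= v k by have /andP[] := vM k.
have a0 k : 0 <= a k by exact/ltW/wa.1.
pose P := series (fun k => a k * v k).
have cvP : P @ \oo --> wsum a v by exact: is_cvg_wsum_ge0 wa vM.
(* Convexity handles the partial sums; the bound then passes to the limit. *)
have PQ N : P N ^+ 3 * c <= \sum_(k < N) 4 ^+ k.+1 * a k ^+ 3 * b k.
  pose h k := 2 ^+ k.+1 * (a k * v k).
  have h0 k : 0 <= h k by rewrite !mulr_ge0// exprn_ge0.
  have -> : P N = \sum_(k < N) 2 ^- k.+1 * h k.
    rewrite /P /series/= big_mkord; apply: eq_bigr => k _.
    by rewrite mulKf// expf_neq0.
  apply: (@le_trans _ _ ((\sum_(k < N) 2 ^- k.+1 * h k ^+ 3) * c)).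
    by rewrite ler_wpM2r// cube_convex_sum.
  rewrite mulr_suml; apply: ler_sum => k _.
  have -> : 2 ^- k.+1 * h k ^+ 3 * c =
      4 ^+ k.+1 * a k ^+ 3 * (v k ^+ 3 * c).
    rewrite (_ : 4 = 2 * 2 :> R); last by rewrite -natrM.
    have : 2 ^+ k.+1 != 0 :> R by rewrite expf_neq0.
    by rewrite /h [(2 * 2) ^+ _]exprMn; move: (2 ^+ k.+1) => p p0; field.
  by rewrite ler_wpM2l// mulr_ge0 ?exprn_ge0.
have Qnneg k : (0 <= (4 ^+ k.+1 * a k ^+ 3 * b k)%:E)%E.
  rewrite lee_fin !mulr_ge0 ?exprn_ge0// (le_trans _ (vb k))//.
  by rewrite mulr_ge0 ?exprn_ge0.
have {}PQ N : ((P N ^+ 3 * c)%:E <=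
    \sum_(0 <= k <oo) (4 ^+ k.+1 * a k ^+ 3 * b k)%:E)%E.
  apply: le_trans (nneseries_lim_ge N (fun k _ _ => Qnneg k)).
  by rewrite sumEFin lee_fin big_mkord.
have cvPc : (fun N => (P N ^+ 3 * c)%:E) @ \oo --> (wsum a v ^+ 3 * c)%:E.
  apply: cvg_EFin; first exact: nearW.
  apply: cvgMl; rewrite (_ : (fun N => _) = P \* P \* P).
    by rewrite !exprS expr0 mulr1 mulrA; apply: cvgM => //; exact: cvgM.
  by apply/funext => N; rewrite /= !exprS expr0 mulr1 mulrA.
rewrite -(cvg_lim _ cvPc)//; apply: lime_le; last exact: nearW.
by apply/cvg_ex; eexists; exact: cvPc.
Qed.

Lemma geometric_weight (R : realType) (z : R) : 0 < z < 1 ->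
  summable_weight (fun k => z ^+ k).
Proof.
move=> /andP[z0 z1]; split=> [k|]; first exact: exprn_gt0.
rewrite (_ : (fun k => _) = geometric 1 z).
  by apply: is_cvg_geometric_series; rewrite gtr0_norm.
by apply/funext => k; rewrite /geometric/= mul1r.
Qed.

(** * Dyadic squares around the point 1 *)

Definition box (R : realType) (i : nat) : set (R * R) :=
  `[1 - 2 * 2 ^- i, 1 + 2 * 2 ^- i]%classic `*`
  `[- (2 * 2 ^- i), 2 * 2 ^- i]%classic.

(** A majorant of [|1 - z + 2^-n|^-2] on the disk. The weight [4 ^+ i] offsets the area, so every
    box adds 16 to the integral; the last index [n.+1] has half-side [2 ^- n], the cut-off. *)
Definition boxes (R : realType) (n : nat) (w : R * R) : R :=
  \sum_(i < n.+2) 4 ^+ i * \1_(@box R i) w.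

Lemma measurable_box (R : realType) i : measurable (@box R i).
Proof. by apply: measurableX; exact: measurable_itv. Qed.

Lemma area_rectangle (R : realType) (A B : set R) (u v : R) :
  measurable A -> measurable B ->
  lebesgue_measure A = u%:E -> lebesgue_measure B = v%:E ->
  (lebesgue_measure \x lebesgue_measure)%E (A `*` B) = (u * v)%:E.
Proof. by move=> mA mB Au Bv; rewrite product_measure1E// EFinM -Au -Bv. Qed.

Lemma lebesgue_itv (R : realType) (x y : R) (b c : bool) : x <= y ->
  lebesgue_measure [set` Interval (BSide b x) (BSide c y)] = (y - x)%:E.
Proof.
move=> xy; rewrite lebesgue_measure_itv/= lte_fin.
by case: ltgtP xy => // <- _; rewrite subrr.
Qed.

Lemma area_box (R : realType) i :
  (lebesgue_measure \x lebesgue_measure)%E (@box R i) = (16 * 4 ^- i)%:E.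
Proof.
have r0 : 0 < 2 * 2 ^- i :> R by rewrite mulr_gt0// expr2V_gt0.
rewrite (@area_rectangle _ _ _ (4 * 2 ^- i) (4 * 2 ^- i)) ?measurable_itv//.
- rewrite (_ : 4 = 2 * 2 :> R) ?exprMn; last by rewrite -natrM.
  by congr EFin; field; rewrite expf_neq0.
- by rewrite lebesgue_itv; [congr EFin; ring|lra].
- by rewrite lebesgue_itv; [congr EFin; ring|lra].
Qed.

Lemma integral_boxes (R : realType) n :
  (\int[lebesgue_measure \x lebesgue_measure]_w (@boxes R n w)%:E =
   (16 * n.+2%:R)%:E)%E.
Proof.
rewrite integral_sum_indic; last 2 first.
- by move=> i; rewrite exprn_ge0.
- exact: measurable_box.
transitivity (\sum_(i < n.+2) (16 : R)%:E)%E.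
  apply: eq_bigr => i _; rewrite [X in (_ * X)%E](area_box R i) -EFinM.
  by congr EFin; rewrite mulrCA mulfV ?mulr1// expf_neq0.
by rewrite sumEFin sumr_const card_ord mulr_natr.
Qed.

(* The dyadic boxes containing z contribute a geometric sum, dominated by the
   smallest one, of the size of 1 - z or of the cut-off 2^-n. *)
Lemma boxes_ge (R : realType) n (z : R[i]) : normc z < 1 ->
  (normc (1 - z + (2 ^- n)%:C))^-1 ^+ 2 <= boxes n (Re z, Im z).
Proof.
move=> z1; set x := Re z; set y := Im z.
have x1 := le_lt_trans (normr_Re_le z) z1.
have y1 := le_lt_trans (normr_Im_le z) z1.
set e := 2 ^- n; have e0 : 0 < e by exact: expr2V_gt0.
(* Distance from [z] to 1 in the sup norm, whose balls are squares. *)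
pose m := Num.max `|1 - x| `|y|.
have mw : m <= normc (1 - z + e%:C).
  rewrite ge_max; apply/andP; split.
    apply: le_trans (normr_Re_le _); rewrite ReDr ReD ReN/= -/x.
    by move: x1; rewrite ltr_norml -/x => /andP[? ?]; rewrite !ger0_norm; lra.
  apply: le_trans (normr_Im_le _); rewrite ImDr ImD/=.
  by rewrite (_ : Im (- z) = - y) ?add0r ?normrN// /y; case: (z).
have ew : e <= normc (1 - z + e%:C).
  apply: le_trans (normr_Re_le _); rewrite ReDr ReD ReN/= -/x.
  by move: x1; rewrite ltr_norml -/x => /andP[? ?]; rewrite !ger0_norm; lra.
have w0 := lt_le_trans e0 ew.
have in_box i : m <= 2 * 2 ^- i -> box i (x, y).
  rewrite ge_max !ler_norml => /andP[/andP[? ?] /andP[? ?]].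
  by split; rewrite /= in_itv/=; apply/andP; split; lra.
(* One box suffices when its weight is at least [t ^- 2] for a lower bound [t] of the modulus. *)
have term i t : (i < n.+2)%N -> m <= 2 * 2 ^- i -> 0 < t ->
    t <= normc (1 - z + e%:C) -> 1 <= 4 ^+ i * t ^+ 2 ->
    (normc (1 - z + e%:C))^-1 ^+ 2 <= boxes n (x, y).
  move=> iN mi t0 tw t4.
  rewrite /boxes (bigD1 (Ordinal iN))//= ler_wpDr//.
    by apply: sumr_ge0 => j _; rewrite mulr_ge0 ?exprn_ge0// indicE ler0n.
  rewrite indicE mem_set ?mulr1; last exact: in_box.
  apply: (@le_trans _ _ (t^-1 ^+ 2)).
    rewrite ler_pXn2r ?nnegrE ?invr_ge0 ?normc_ge0 ?(ltW t0)//.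
    by rewrite lef_pV2 ?posrE.
  by rewrite exprVn -div1r ler_pdivrMr// exprn_gt0.
have m2 : m <= 2.
  by rewrite ge_max !ler_norml; move: x1 y1; rewrite !ltr_norml -/x -/y; lra.
have four i : 4 ^+ i * (2 ^- i) ^+ 2 = 1 :> R.
  rewrite (_ : 4 = 2 * 2 :> R); last by rewrite -natrM.
  by rewrite exprMn; field; rewrite expf_neq0.
(* Below the cut-off, box [n.+1] is used with [t = e]; otherwise box [i], with [t] the inner edge of
   the band containing [m]. *)
have [mN|[i iN /andP[im mi]]] := dyadic_scale n.+1 m2.
- apply: (term n.+1 e) => //; rewrite exprS -mulrA four mulr1.
  by rewrite ler1n.
- apply: (term i (2 * 2 ^- i.+1) (leqW iN) mi).
  + by rewrite mulr_gt0// expr2V_gt0.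
  + exact: le_trans (ltW im) mw.
  + by rewrite expr2VS [2 * _]mulrC divfK// four.
Qed.

(** * The map and its membership in A_1^3 *)

Definition wt (R : realType) (k : nat) : R := 16^-1 ^+ k.

Definition eps (R : realType) (k : nat) : R := 2 ^- (512 ^ k).

Definition pole_series (R : realType) (z : R[i]) : R[i] :=
  stieltjes (@wt R) (@eps R) (1 - z).

Lemma wt_summable (R : realType) : summable_weight (@wt R).
Proof. by apply: geometric_weight; rewrite invr_gt0 invf_lt1 ?ltr1n ltr0n. Qed.

Lemma eps_gt0 (R : realType) k : 0 < @eps R k.
Proof. exact: expr2V_gt0. Qed.

Lemma eps_ge0 (R : realType) k : 0 <= @eps R k.
Proof. exact: ltW (eps_gt0 R k). Qed.

Lemma Re_1B_gt0 (R : realType) (z : R[i]) : unit_disk z -> 0 < Re (1 - z).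
Proof.
move=> z1; have := le_lt_trans (normr_Re_le z) z1.
by rewrite ltr_norml ReD ReN/= subr_gt0 => /andP[].
Qed.

Lemma pole_series_conformal (R : realType) : conformal_mapping (@pole_series R).
Proof.
split=> [z z1|z1 z2].
  apply: (derivable_stieltjes1B (@wt_summable R) (@eps_ge0 R)).
  by have := Re_1B_gt0 z1; rewrite ReD ReN/= subr_gt0.
rewrite !inE => h1 h2 /(stieltjes_inj (@wt_summable R) (@eps_ge0 R)
  (Re_1B_gt0 h1) (Re_1B_gt0 h2)).
by move=> /addrI /oppr_inj.
Qed.

Lemma pole_series_ge (R : realType) (z : R[i]) k : unit_disk z ->
  wt R k / normc (1 - z + (eps R k)%:C) <= normc (pole_series z).
Proof.
move=> /Re_1B_gt0; apply: normc_stieltjes_ge.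
- exact: wt_summable.
- exact: eps_ge0.
Qed.

Lemma measurable_boxes (R : realType) n :
  measurable_fun [set: R * R] (@boxes R n).
Proof.
apply: measurable_sum => i; apply: measurable_funM.
  exact: measurable_cst.
by apply: measurable_indic; exact: measurable_box.
Qed.

Lemma boxes_ge0 (R : realType) n (w : R * R) : 0 <= boxes n w.
Proof. by apply: sumr_ge0 => i _; rewrite mulr_ge0 ?exprn_ge0// indicE ler0n. Qed.

(** The weight is at most [2 * (1 - normc z)], hence at most twice [|1 - z + e_k|] for every k. It
    absorbs one of three factors [1 / |1 - z + e_k|] and leaves a square for [boxes_ge]. *)
Lemma pole_series_cube_le (R : realType) (z : R[i]) : unit_disk z ->
  ((normc (pole_series z) ^+ 3 * (1 - normc z ^+ 2))%:E <=
   \sum_(0 <= k <oo) (4 ^+ k.+1 * wt R k ^+ 3 *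
      (16 * boxes (512 ^ k) (Re z, Im z)))%:E)%E.
Proof.
move=> z1; have w0 := Re_1B_gt0 z1.
pose v k := (normc (1 - z + (eps R k)%:C))^-1.
have vM k : 0 <= v k <= (Re (1 - z))^-1.
  by rewrite /v -normcV normc_ge0 normc_inv_shift_le// eps_ge0.
have z0 := normc_ge0 z.
have c0 : 0 <= 1 - normc z ^+ 2 by rewrite subr_ge0 expr_le1// ltW.
have cw k : 1 - normc z ^+ 2 <= 2 * (v k)^-1.
  have : 1 - normc z <= (v k)^-1.
    rewrite invrK; apply: le_trans (normr_Re_le _); rewrite ReDr ReD ReN/=.
    have := le_trans (ler_norm _) (normr_Re_le z).
    move: (eps_gt0 R k) (ler_norm (1 - Re z + eps R k)); lra.
  by move: z1; rewrite /unit_disk/=; nra.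
(* Here 8 is the cube of the factor 2 in [normc_csum_le]; [cw] turns it into 16. *)
apply: (@le_trans _ _ (wsum (@wt R) v ^+ 3 * (8 * (1 - normc z ^+ 2)))%:E).
  have -> : wsum (@wt R) v ^+ 3 * (8 * (1 - normc z ^+ 2)) =
      (2 * wsum (@wt R) v) ^+ 3 * (1 - normc z ^+ 2) by ring.
  rewrite lee_fin ler_wpM2r//.
  have le_csum : normc (pole_series z) <= 2 * wsum (@wt R) v.
    apply: (normc_csum_le (@wt_summable R)) => k.
    by have /andP[_ vk] := vM k; apply/andP; split; [rewrite normcV|exact: vk].
  by rewrite ler_pXn2r// nnegrE ?normc_ge0// (le_trans _ le_csum)// normc_ge0.
apply: (wsum_cube_le (@wt_summable R) vM); first by rewrite mulr_ge0.
move=> k; have /andP[v0 _] := vM k.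
have := boxes_ge (512 ^ k) z1; rewrite -/(eps R k) -/(v k) => vb.
have [vk0|vk0] := eqVneq (v k) 0.
  by rewrite vk0 expr0n mul0r mulr_ge0// boxes_ge0.
apply: (@le_trans _ _ (16 * v k ^+ 2)); last by rewrite ler_wpM2l.
rewrite mulrCA mulrA.
apply: le_trans (ler_wpM2l (mulr_ge0 (ler0n R 8) (exprn_ge0 3 v0)) (cw k)) _.
by rewrite (_ : 8 * v k ^+ 3 * _ = 16 * v k ^+ 2)//; field.
Qed.

Lemma pole_series_bergman31 (R : realType) : bergman_space 3 1 (@pole_series R).
Proof.
split; first by case: (pole_series_conformal R).
pose G k (w : R * R) : \bar R :=
  (4 ^+ k.+1 * wt R k ^+ 3 * (16 * boxes (512 ^ k) w))%:E.
have C0 k : 0 <= 4 ^+ k.+1 * wt R k ^+ 3.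
  by rewrite mulr_ge0 ?exprn_ge0// (ltW ((wt_summable R).1 k)).
have G0 k w : (0 <= G k w)%E.
  by rewrite lee_fin mulr_ge0// mulr_ge0// boxes_ge0.
(* With the integrand extended by zero, a pointwise bound on the whole plane suffices, and only the
   majorant must be measurable. *)
rewrite /area_integral integral_mkcond.
apply: (@le_lt_trans _ _
  (\int[lebesgue_measure \x lebesgue_measure]_w (\sum_(0 <= k <oo) G k w))%E).
  have p0 (w : R * R) : unit_disk (w.1 +i* w.2) ->
      normc (pole_series (w.1 +i* w.2)) `^ 3 * (1 - normc (w.1 +i* w.2) ^+ 2) `^ 1 =
      normc (pole_series (w.1 +i* w.2)) ^+ 3 * (1 - normc (w.1 +i* w.2) ^+ 2).
    move=> w1; rewrite powRr1 ?powR_mulrn ?normc_ge0//.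
    by rewrite subr_ge0 expr_le1 ?normc_ge0// ltW.
  apply: nonneg_le_integral => w.
    by apply: erestrict_ge0 => x _; rewrite lee_fin mulr_ge0 ?powR_ge0.
  rewrite patchE; case: ifPn => [|_]; last by apply: nneseries_ge0.
  by rewrite inE/= => w1; rewrite p0//; exact: pole_series_cube_le.
rewrite integral_nneseries//; last first.
  move=> k; apply/measurable_EFinP.
  do 2 (apply: measurable_funM; first exact: measurable_cst).
  exact: measurable_boxes.
have intG k : (\int[lebesgue_measure \x lebesgue_measure]_w G k w =
    (4 ^+ k.+1 * wt R k ^+ 3 * 16 * (16 * (512 ^ k).+2%:R))%:E)%E.
  rewrite EFinM -integral_boxes -ge0_integralZl_EFin//.
  - by apply: eq_integral => w _; rewrite /G -EFinM mulrA.
  - by move=> w _; rewrite lee_fin boxes_ge0.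
  - by apply/measurable_EFinP; exact: measurable_boxes.
  - by rewrite mulr_ge0.
(* The ratio is [4 * 512 / 16^3 = 1/2] and the constant [4 * 16 * 16 * 3 = 3072], half of 6144; the
   3 comes from [n3]. *)
apply: (@le_lt_trans _ _
    (\sum_(0 <= k <oo) ((6144 : R) / (2 ^ (k + 1))%:R)%:E)%E).
  apply: lee_nneseries => k _; first by move=> _; exact: integral_ge0.
  rewrite intG lee_fin /wt natrX addn1.
  have n3 : (512 ^ k).+2%:R <= 3 * 512 ^+ k :> R.
    rewrite -natrX -natrM ler_nat -addn2 mulSn leq_add2l -[leqLHS]muln1.
    by rewrite leq_mul2l expn_gt0.
  have c0 : 0 <= 4 ^+ k.+1 * (16^-1 ^+ k) ^+ 3 * 16 * 16 :> R.
    by rewrite !mulr_ge0 ?exprn_ge0 ?invr_ge0.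
  rewrite mulrA; apply: le_trans (ler_wpM2l c0 n3) _.
  have -> : 4 ^+ k.+1 * (16^-1 ^+ k) ^+ 3 * 16 * 16 * (3 * 512 ^+ k) =
     3072 * (4 * 16^-1 ^+ 3 * 512) ^+ k :> R.
    rewrite 2!exprMn [in RHS]exprAC (exprS 4 k).
    by move: (4 ^+ k) ((16^-1 ^+ k) ^+ 3) (512 ^+ k) => x y z; ring.
  rewrite (_ : 4 * 16^-1 ^+ 3 * 512 = 2^-1); last by field.
  rewrite exprVn exprS [leRHS](_ : _ = 3072 * 2 ^- k)//.
  by field; rewrite expf_neq0.
have := @cvg_geometric_eseries_half R 6144 0.
rewrite /eseries => cvs.
by rewrite (cvg_lim _ cvs)// ltry.
Qed.

(** * Divergence of the A_0^2 area integral *)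

Lemma pole_series_not_bergman20 (R : realType) : ~ bergman_space 2 0 (@pole_series R).
Proof.
move=> [_]; rewrite /area_integral integral_mkcond.
apply: (@unbounded_exp2 _ 36^-1); first by rewrite invr_gt0.
move=> k; set n := (512 ^ k)%N; set a := wt R k.
(* Squares of side [2 ^- i.+1] resting on the real axis, half-open in the first coordinate to be
   disjoint. *)
pose Q i : set (R * R) := `[1 - 2 ^- i, 1 - 2 ^- i.+1[%classic `*`
  `[0, 2 ^- i.+1]%classic.
(* On [Q i] with [i < n], each of [1 - w.1], [w.2] and [eps R k] is at most [2 ^- i], whence the
   3. *)
pose c i := (a / (3 * 2 ^- i)) ^+ 2.
have QE i w : Q i w -> 2 ^- i.+1 < 1 - w.1 <= 2 ^- i /\ 0 <= w.2 <= 2 ^- i.+1.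
  by move=> []; rewrite /= !in_itv/= => /andP[? ?] ?; split=> //; lra.
have mQ i : measurable (Q i) by apply: measurableX; exact: measurable_itv.
have areaQ i : (lebesgue_measure \x lebesgue_measure)%E (Q i) =
    (2 ^- i.+1 * 2 ^- i.+1)%:E.
  have p0 := expr2V_gt0 R i; have := expr2VS R i => p1.
  apply: area_rectangle; rewrite ?measurable_itv//.
    by rewrite lebesgue_itv; [congr EFin; lra|lra].
  by rewrite lebesgue_itv; [congr EFin; lra|lra].
have -> : (36^-1 * 2 ^+ k)%:E =
    (\int[lebesgue_measure \x lebesgue_measure]_w
      (\sum_(i < n) c i * \1_(Q i) w)%R%:E)%E.
  rewrite integral_sum_indic//; last by move=> i; exact: sqr_ge0.
  (* Each square contributes the same amount, and [n * a ^+ 2 = (512 / 16^2)^k = 2^k]. *)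
  transitivity (\sum_(i < n) (a ^+ 2 / 36)%:E)%E.
    rewrite sumEFin sumr_const card_ord; congr EFin.
    rewrite -[RHS]mulr_natr /a /wt /n natrX mulrAC exprAC -exprMn [RHS]mulrC.
    by congr (_ * _ ^+ k); field.
  apply: eq_bigr => i _; rewrite [X in (_ * X)%E](areaQ i) -EFinM.
  by congr EFin; rewrite /c expr2VS; field; rewrite expf_neq0.
apply: nonneg_le_integral => w.
  by rewrite lee_fin sumr_ge0// => i _; rewrite mulr_ge0 ?sqr_ge0// indicE ler0n.
have Qinj i j : Q i w -> Q j w -> i = j.
  by move=> /QE[wi _] /QE[wj _]; exact: dyadic_scale_uniq wi wj.
have Qdisk i : Q i w -> unit_disk (w.1 +i* w.2).
  move=> /QE[/andP[w1 w2] /andP[w3 w4]].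
  have i1 : 2 ^- i <= 1 :> R by have := @ler_expr2V R 0 i (leq0n i); rewrite expr0 invr1.
  rewrite /unit_disk/= -[ltRHS]sqrtr1 ltr_sqrt//.
  (* With [s = 1 - w.1], [w.2^2 < s^2 <= s] gives [w.1^2 + w.2^2 < 1 - 2 s + 2 s^2 <= 1]. *)
  have : w.2 ^+ 2 <= w.2 * (1 - w.1) by rewrite expr2 ler_wpM2l//; lra.
  have : w.2 * (1 - w.1) < (1 - w.1) * (1 - w.1) by rewrite ltr_pM2r; lra.
  have : (1 - w.1) * (1 - w.1) <= 1 - w.1 by rewrite ger_pMr; lra.
  by rewrite !expr2; lra.
rewrite patchE; case: ifPn => [|wD].
  move=> /set_mem wD; rewrite powRr0 mulr1 powR_mulrn ?normc_ge0// lee_fin.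
  apply: sum_indic_le => //; first exact: sqr_ge0.
  move=> i i_n Qi; have [/andP[w1 w2] /andP[w3 w4]] := QE _ _ Qi.
  have p0 := expr2V_gt0 R i.
  have a0 : 0 < a by exact: (wt_summable R).1.
  rewrite /c ler_pXn2r ?nnegrE ?normc_ge0 ?divr_ge0 ?mulr_ge0 ?(ltW p0) ?(ltW a0)//.
  apply: le_trans (pole_series_ge k wD); rewrite ler_pM2l//.
  have e1 : eps R k <= 2 ^- i.+1 by exact: ler_expr2V.
  have e0 := eps_gt0 R k.
  have wpos : 0 < normc (1 - (w.1 +i* w.2) + (eps R k)%:C).
    apply: lt_le_trans (normr_Re_le _); apply: lt_le_trans (ler_norm _).
    by rewrite ReDr/=; lra.
  rewrite lef_pV2 ?posrE// ?mulr_gt0//.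
  apply: le_trans (normc_le_ReIm _) _; rewrite ReDr ImDr/= sub0r normrN.
  by rewrite !ger0_norm; lra.
rewrite lee_fin big1// => i _; rewrite indicE memNset ?mulr0// => /Qdisk wd.
by move: wD; rewrite notin_setE.
Qed.

(** * Divergence of the H^1 means *)

Lemma normc_circle_le (R : realType) (r e t : R) : 0 <= r <= 1 -> 0 <= e ->
  0 <= t <= 2 -> normc (1 - circle_point r t + e%:C) <= (1 - r) + e + t.
Proof.
move=> /andP[r0 r1] e0 t02; have /andP[t0 t2] := t02.
(* The point is split as [(1 - r + e) + r (1 - e^{it})], and the chord satisfies
   [|1 - e^{it}|^2 = 2 (1 - cos t) <= t^2]. *)
have -> : 1 - circle_point r t + e%:C =
    (1 - r + e)%:C + (r * (1 - cos t)) +i* (- (r * sin t)).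
  by apply/eqP; rewrite eq_complex/=; apply/andP; split; apply/eqP; ring.
apply: le_trans (le_normcD _ _) _; apply: lerD.
  by rewrite /= expr0n addr0 sqrtr_sqr ger0_norm// addr_ge0// subr_ge0.
rewrite /= -[leRHS]ger0_norm// -sqrtr_sqr ler_wsqrtr//.
have -> : (r * (1 - cos t)) ^+ 2 + (- (r * sin t)) ^+ 2 =
    r ^+ 2 * (2 * (1 - cos t)).
  have -> : (- (r * sin t)) ^+ 2 = r ^+ 2 * sin t ^+ 2 by ring.
  by rewrite sin2cos2; ring.
have := cos_ge t02; have := cos_le1 t => c1 c2.
have r2 : r ^+ 2 <= 1 by rewrite expr_le1.
by apply: le_trans (ler_wpM2r _ r2) _; lra.
Qed.

Lemma pole_series_not_hardy1 (R : realType) : ~ hardy_space 1 (@pole_series R).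
Proof.
move=> [_]; apply: (@unbounded_exp2 _ 6^-1); first by rewrite invr_gt0.
move=> k; set n := (512 ^ k)%N; set a := wt R k; set e := eps R k.
have e0 : 0 < e by exact: eps_gt0.
have n0 : (0 < n)%N by rewrite expn_gt0.
have e2 : e <= 2^-1 by have := @ler_expr2V R 1 n n0; rewrite expr1.
have a0 : 0 < a by exact: (wt_summable R).1.
(* The radius [1 - e] depends on [k]: its gap to 1 equals the shift of the k-th pole. *)
apply: (@le_trans _ _ (\int[lebesgue_measure]_(t in `[0%R, (2 * pi)%R])
   ((normc (pole_series (circle_point (1 - e) t)) `^ 1)%R)%:E)%E); last first.
  apply: ereal_sup_ubound; exists (1 - e) => //=.
  by rewrite in_itv/=; apply/andP; split; lra.
rewrite integral_mkcond.
pose J i : set R := `]2 ^- i.+1, 2 ^- i]%classic.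
(* For [i < n] and [t] in [J i], the modulus is at most [2 * e + t], below [3 * 2 ^- i]; each arc
   then contributes [a / 6]. *)
pose c i := a / (3 * 2 ^- i).
have c_ge0 i : 0 <= c i.
  by rewrite divr_ge0 ?mulr_ge0 ?(ltW a0) ?(ltW (expr2V_gt0 R i)).
have mJ i : measurable (J i) by exact: measurable_itv.
have lenJ i : lebesgue_measure (J i) = (2 ^- i.+1)%:E :> \bar R.
  have p0 := expr2V_gt0 R i; have := expr2VS R i => p1.
  by rewrite lebesgue_itv; [congr EFin; lra|lra].
apply: (@le_trans _ _ (\int[lebesgue_measure]_t
      (\sum_(i < n) c i * \1_(J i) t)%R%:E)%E).
  rewrite integral_sum_indic//.
  (* The arcs give [n * a / 6 = 32^k / 6], more than the required [2^k / 6]. *)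
  apply: (@le_trans _ _ (\sum_(i < n) (a / 6)%:E)%E).
    rewrite sumEFin sumr_const card_ord lee_fin.
    rewrite -[leRHS]mulr_natr /a /wt /n natrX mulrAC -exprMn [leRHS]mulrC ler_wpM2l//.
    by rewrite lerXn2r ?nnegrE//; lra.
  apply: lee_sum => i _; rewrite [X in (_ * X)%E](lenJ i) -EFinM lee_fin.
  rewrite le_eqVlt; apply/orP; left; apply/eqP.
  by rewrite /c expr2VS; field; rewrite expf_neq0.
apply: nonneg_le_integral => t.
  by rewrite lee_fin sumr_ge0// => i _; rewrite mulr_ge0// indicE ler0n.
have Jinj i j : J i t -> J j t -> i = j.
  by rewrite /J/= !in_itv/=; exact: dyadic_scale_uniq.
have J01 i : J i t -> 0 < t <= 1.
  rewrite /J/= in_itv/= => /andP[t1 t2]; have := expr2V_gt0 R i.+1.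
  by have := @ler_expr2V R 0 i (leq0n i); rewrite expr0 invr1; lra.
(* This puts the arcs, all inside []0, 1]], within the range of integration. *)
have pi2 := pi_ge2 R.
rewrite patchE; case: ifPn => [_|tD].
  rewrite powRr1 ?normc_ge0// lee_fin.
  apply: sum_indic_le => //; first exact: normc_ge0.
  move=> i i_n Ji; have /andP[t0 t1] := J01 _ Ji.
  have {Ji} /andP[t2 t3] : 2 ^- i.+1 < t <= 2 ^- i by move: Ji; rewrite /J/= in_itv.
  have wD : unit_disk (circle_point (1 - e) t).
    rewrite /unit_disk/= !exprMn -mulrDr cos2Dsin2 mulr1 sqrtr_sqr ger0_norm; lra.
  apply: le_trans (pole_series_ge k wD); rewrite ler_pM2l// -/e.
  have e1 : e <= 2 ^- i.+1 by exact: ler_expr2V.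
  have wpos : 0 < normc (1 - circle_point (1 - e) t + e%:C).
    apply: lt_le_trans (normr_Re_le _); apply: lt_le_trans (ler_norm _).
    rewrite ReDr/=.
    have : (1 - e) * cos t <= 1 - e by rewrite ger_pMr ?cos_le1//; lra.
    lra.
  have p0 := expr2V_gt0 R i.
  rewrite lef_pV2 ?posrE ?mulr_gt0//.
  apply: le_trans (normc_circle_le _ _ _) _; [lra|lra|lra|].
  by have := expr2VS R i; lra.
rewrite lee_fin big1// => i _; rewrite indicE memNset ?mulr0// => /J01 t01.
by move: tD; rewrite notin_setE/= in_itv/=; apply; lra.
Qed.

Theorem mainTheorem12 (R : realType) :
  exists f : R[i] -> R[i],
    [/\ conformal_mapping f,
        bergman_space 3 1 f,
        ~ bergman_space 2 0 f &
        ~ hardy_space 1 f].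
Proof.
exists (@pole_series R); split.
- exact: pole_series_conformal.
- exact: pole_series_bergman31.
- exact: pole_series_not_bergman20.
- exact: pole_series_not_hardy1.
Qed.
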